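(* Let $(M,g)$, $n=\dim M\geq4$, be a semi-Riemannian manifold whose curvature tensor satisfies on ${\mathcal U}_S\cap{\mathcal U}_C\subset M$ $$R=\frac\phi2\,S\wedge S+\mu\,g\wedge S+\eta\,G$$ for some functions $\phi,\mu,\eta$ on ${\mathcal U}_S\cap{\mathcal U}_C$. Then on this set $$C\cdot R+R\cdot C=Q(S,C)+\Big(L+L_C-\frac1{(n-2)\phi}\Big)Q(g,C),$$ $$C\cdot R-R\cdot C=Q(S,C)-\frac\kappa{n-1}\,Q(g,C),$$ where $L=L_R+\frac\mu\phi$, $L_C=L_R-\frac\kappa{n-1}+\frac1{(n-2)\phi}-\frac\mu\phi$ and $L_R=\frac1\phi\big((n-2)(\mu^2-\phi\eta)-\mu\big)$.
   Context: All manifolds are connected, paracompact and of class $C^\infty$. For a semi-Riemannian manifold $(M,g)$, $n=\dim M$, with Levi-Civita connection $\nabla$: ${\mathcal R}(X,Y)Z=\nabla_X\nabla_YZ-\nabla_Y\nabla_XZ-\nabla_{[X,Y]}Z$, $R(X_1,X_2,X_3,X_4)=g({\mathcal R}(X_1,X_2)X_3,X_4)$, $S(X,Y)=\mathrm{tr}\{Z\mapsto{\mathcal R}(Z,X)Y\}$, $\kappa$ is the scalar curvature (the $g$-trace of $S$). For symmetric $(0,2)$-tensors $E,F$: $(E\wedge F)(X_1,X_2,X_3,X_4)=E(X_1,X_4)F(X_2,X_3)+E(X_2,X_3)F(X_1,X_4)-E(X_1,X_3)F(X_2,X_4)-E(X_2,X_4)F(X_1,X_3)$; $G=\frac12g\wedge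 g$; $C=R-\frac1{n-2}g\wedge S+\frac\kappa{(n-2)(n-1)}G$ is the Weyl tensor. For $B\in\{R,C\}$ define ${\mathcal B}$ by $g({\mathcal B}(X_1,X_2)X_3,X_4)=B(X_1,X_2,X_3,X_4)$; for a $(0,k)$-tensor $T$, $(B\cdot T)(X_1,\dots,X_k,X,Y)=-\sum_iT(X_1,\dots,{\mathcal B}(X,Y)X_i,\dots,X_k)$. For a symmetric $(0,2)$-tensor $A$, $(X\wedge_AY)Z=A(Y,Z)X-A(X,Z)Y$ and $Q(A,T)(X_1,\dots,X_k,X,Y)=-\sum_iT(X_1,\dots,(X\wedge_AY)X_i,\dots,X_k)$. ${\mathcal U}_S$ is the set of points where $S\ne\frac\kappa ng$; ${\mathcal U}_C$ is the set of points where $C\neq0$. (At points of ${\mathcal U}_S\cap{\mathcal U}_C$ the decomposition of $R$ forces $\phi\ne0$, since $\phi=0$ would give $C=0$.) *)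

(* Defs.v *)
From HB Require Import structures.
From mathcomp Require Import all_boot all_order all_algebra.
From mathcomp Require Import all_classical all_reals all_analysis.
From mathcomp Require Import ring.

Set Implicit Arguments.
Unset Strict Implicit.
Unset Printing Implicit Defensive.

Import Order.TTheory GRing.Theory Num.Theory.
Import numFieldNormedType.Exports.
Local Open Scope classical_set_scope.
Local Open Scope ring_scope.

(* Tensors on R^n, the tangent space of a point in the coordinates of a chart;
   a covariant tensor is the function giving its values on vectors. *)
Section Tensors.
Context {R : realType} {n : nat}.
Local Notation V := 'rV[R]_n.

Definition tensor2 := V -> V -> R.
Definition tensor4 := V -> V -> V -> V -> R.

Definition bil (g : 'M[R]_n) : tensor2 := fun X Y => (X *m g *m Y^T) 0 0.

(* The vector W such that g(W, Z) = alpha Z for all Z (see [bil_sharp]). *)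
Definition sharp (g : 'M[R]_n) (alpha : V -> R) : V :=
  (\row_l alpha 'e_l) *m invmx g.

Definition gtrace (g : 'M[R]_n) (E : tensor2) : R :=
  \sum_(i < n) \sum_(j < n) invmx g i j * E 'e_i 'e_j.

(* Kulkarni-Nomizu product. *)
Definition kn (E F : tensor2) : tensor4 := fun X1 X2 X3 X4 =>
  E X1 X4 * F X2 X3 + E X2 X3 * F X1 X4
  - E X1 X3 * F X2 X4 - E X2 X4 * F X1 X3.

Definition Gtensor (g : 'M[R]_n) : tensor4 := fun X1 X2 X3 X4 =>
  2^-1 * kn (bil g) (bil g) X1 X2 X3 X4.

(* Derivation of the tensor algebra induced by A, which kills functions. *)
Definition derive_by (A : V -> V) (T : tensor4) : tensor4 := fun X1 X2 X3 X4 =>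
  - (T (A X1) X2 X3 X4 + T X1 (A X2) X3 X4
     + T X1 X2 (A X3) X4 + T X1 X2 X3 (A X4)).

Definition opr (g : 'M[R]_n) (B : tensor4) (X Y Z : V) : V :=
  sharp g (B X Y Z).

Definition dot (g : 'M[R]_n) (B T : tensor4) (X1 X2 X3 X4 X Y : V) : R :=
  derive_by (opr g B X Y) T X1 X2 X3 X4.

Definition wedge_op (A : tensor2) (X Y Z : V) : V := A Y Z *: X - A X Z *: Y.

Definition Qtensor (A : tensor2) (T : tensor4) (X1 X2 X3 X4 X Y : V) : R :=
  derive_by (wedge_op A X Y) T X1 X2 X3 X4.

Lemma bilE (g : 'M[R]_n) (X Y : V) :
  bil g X Y = \sum_(j < n) \sum_(i < n) X 0 i * g i j * Y 0 j.
Proof.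
rewrite /bil mxE; apply: eq_bigr => j _.
by rewrite !mxE mulr_suml.
Qed.

Lemma bilC (g : 'M[R]_n) (X Y : V) : g^T = g -> bil g X Y = bil g Y X.
Proof.
move=> gT; rewrite /bil.
by rewrite (_ : X *m g *m Y^T = (Y *m g *m X^T)^T) 1?mxE// !trmx_mul trmxK gT mulmxA.
Qed.

Lemma bilDl (g : 'M[R]_n) (X Y Z : V) :
  bil g (X + Y) Z = bil g X Z + bil g Y Z.
Proof. by rewrite /bil !mulmxDl mxE. Qed.

Lemma bilDr (g : 'M[R]_n) (X Y Z : V) :
  bil g Z (X + Y) = bil g Z X + bil g Z Y.
Proof. by rewrite /bil linearD mulmxDr mxE. Qed.

Lemma bilZr (g : 'M[R]_n) k (X Z : V) : bil g Z (k *: X) = k * bil g Z X.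
Proof. by rewrite /bil linearZ -scalemxAr mxE. Qed.

Lemma bilDg (g h : 'M[R]_n) (X Y : V) : bil (g + h) X Y = bil g X Y + bil h X Y.
Proof. by rewrite /bil mulmxDr mulmxDl mxE. Qed.

Lemma bilZg (g : 'M[R]_n) k (X Y : V) : bil (k *: g) X Y = k * bil g X Y.
Proof. by rewrite /bil -scalemxAr -scalemxAl mxE. Qed.

Lemma bil0l (g : 'M[R]_n) (X : V) : bil g 0 X = 0.
Proof. by rewrite /bil !mul0mx mxE. Qed.

Lemma bil0r (g : 'M[R]_n) (X : V) : bil g X 0 = 0.
Proof. by rewrite /bil linear0 mulmx0 mxE. Qed.

Lemma bil_sharp (g : 'M[R]_n) (alpha : V -> R) (Z : V) :
  g \in unitmx -> scalar alpha -> bil g (sharp g alpha) Z = alpha Z.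
Proof.
move=> gU alin.
pose L := GRing.isLinear.Build R V R *%R alpha alin.
pose beta : {linear V -> R | *%R} := HB.pack alpha L.
rewrite /bil /sharp mulmxKV// [in RHS](row_sum_delta Z) -[alpha]/(beta : V -> R).
rewrite linear_sum !mxE; apply: eq_bigr => i _.
by rewrite linearZ !mxE /= mulrC.
Qed.

Lemma sharp_bil (g : 'M[R]_n) (W : V) :
  g \in unitmx -> sharp g (bil g W) = W.
Proof.
move=> gU; rewrite /sharp -[RHS](mulmxK gU); congr (_ *m _).
by apply/rowP => l; rewrite mxE /bil trmx_delta -colE mxE.
Qed.

End Tensors.

(* Semi-Riemannian geometry of an open set of R^n with metric h: the tangent
   spaces are R^n and vector fields are functions R^n -> R^n. *)
Section LocalGeometry.
Context {R : realType} {n : nat}.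
Local Notation V := 'rV[R]_n.
Implicit Types (h : V -> 'M[R]_n) (x : V).

(* Koszul formula on fields with constant components. *)
Definition christoffel h x (u v : V) : V :=
  sharp (h x) (fun w => 2^-1 * ('D_u (fun y => bil (h y) v w) x
    + 'D_v (fun y => bil (h y) u w) x - 'D_w (fun y => bil (h y) u v) x)).

(* Levi-Civita connection of h, see [nabla_torsion_free], [nabla_metric]. *)
Definition nabla h (X Y : V -> V) : V -> V := fun x =>
  'D_(X x) Y x + christoffel h x (X x) (Y x).

Definition lie_bracket (X Y : V -> V) : V -> V := fun x => 'D_(X x) Y x - 'D_(Y x) X x.

Definition curvature_field h (X Y Z : V -> V) : V -> V := fun x =>
  nabla h X (nabla h Y Z) x - nabla h Y (nabla h X Z) x
  - nabla h (lie_bracket X Y) Z x.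

Lemma christoffelC h x (u v : V) :
  (\forall y \near x, (h y)^T = h y) -> christoffel h x u v = christoffel h x v u.
Proof.
move=> hsym; congr sharp; apply/funext => w; congr (_ * (_ - _)).
  by rewrite addrC.
by apply: near_eq_derive; near=> y; apply: bilC; near: y.
Unshelve. all: by end_near. Qed.

Lemma nabla_torsion_free h (X Y : V -> V) x :
  (\forall y \near x, (h y)^T = h y) ->
  nabla h X Y x - nabla h Y X x = lie_bracket X Y x.
Proof.
move=> hsym.
by rewrite /nabla (christoffelC _ (Y x))// opprD addrACA subrr addr0.
Qed.

Lemma is_derive_entry p q (A : V -> 'M[R]_(p, q)) x u i j :
  derivable A x u -> is_derive x u (fun y => A y i j) ('D_u A x i j).
Proof.
move=> dA; rewrite derive_mx// mxE; apply: derivableP.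
by move/derivable_mxP: dA => /(_ i j).
Qed.

Lemma derive_bil h (Y Z : V -> V) x u :
  differentiable h x -> differentiable Y x -> differentiable Z x ->
  'D_u (fun y => bil (h y) (Y y) (Z y)) x =
  bil ('D_u h x) (Y x) (Z x) + bil (h x) ('D_u Y x) (Z x)
  + bil (h x) (Y x) ('D_u Z x).
Proof.
move=> /(@diff_derivable _ _ _ _ _ u) dh /(@diff_derivable _ _ _ _ _ u) dY.
move=> /(@diff_derivable _ _ _ _ _ u) dZ.
have hij i j := is_derive_entry i j dh.
have Yi i := is_derive_entry 0 i dY.
have Zi i := is_derive_entry 0 i dZ.
rewrite (_ : (fun y => _) = \sum_(j < n) \sum_(i < n)
    (fun y => Y y 0 i) * (fun y => h y i j) * (fun y => Z y 0 j)); last first.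
  apply/funext => y; rewrite bilE fct_sumE; apply: eq_bigr => j _.
  by rewrite fct_sumE.
rewrite !bilE -!big_split/= derive_val; apply: eq_bigr => j _.
rewrite -!big_split/=; apply: eq_bigr => i _.
rewrite /GRing.scale /= !fctE; ring.
Qed.

Lemma nabla_metric h (X Y Z : V -> V) x :
  h x \in unitmx -> (\forall y \near x, (h y)^T = h y) ->
  differentiable h x -> differentiable Y x -> differentiable Z x ->
  'D_(X x) (fun y => bil (h y) (Y y) (Z y)) x =
  bil (h x) (nabla h X Y x) (Z x) + bil (h x) (Y x) (nabla h X Z x).
Proof.
move=> hU hsym dh dY dZ.
have hx : (h x)^T = h x := nbhs_singleton hsym.
have dcst (v w : V) u : 'D_u (fun y => bil (h y) v w) x = bil ('D_u h x) v w.
  rewrite (@derive_bil h (cst v) (cst w))// !derive_cst bil0l bil0r.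
  by rewrite !addr0.
have csym u (v w : V) : bil ('D_u h x) v w = bil ('D_u h x) w v.
  rewrite -!dcst; apply: near_eq_derive; near=> y; apply: bilC; near: y.
  exact: hsym.
have chr u (v w : V) : bil (h x) (christoffel h x u v) w =
    2^-1 * (bil ('D_u h x) v w + bil ('D_v h x) u w - bil ('D_w h x) u v).
  rewrite bil_sharp//; first by rewrite !dcst.
  move=> k a b; rewrite !dcst (_ : 'D_(k *: a + b) h x =
    k *: 'D_a h x + 'D_b h x); last by rewrite !(deriveE _ dh) linearP.
  move: ('D_u h x) ('D_v h x) ('D_a h x) ('D_b h x) => A B C D.
  rewrite !bilDr !bilZr bilDg bilZg.
  by rewrite /GRing.scale /=; ring.
rewrite (derive_bil _ dh dY dZ) /nabla bilDl bilDr.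
rewrite [bil (h x) (Y x) (christoffel _ _ _ _)]bilC// !chr.
have alg (a b c d s t : R) : d = a ->
    a + s + t = s + 2^-1 * (a + b - c) + (t + 2^-1 * (d + c - b)).
  by move=> ->; field.
exact: alg.
Unshelve. all: by end_near. Qed.

(* The value at x depends only on the values of the fields at x: tangent
   vectors are extended by fields with constant components. *)
Definition curvature_op h x (u v w : V) : V :=
  curvature_field h (fun=> u) (fun=> v) (fun=> w) x.

Definition curvature h x : tensor4 := fun X1 X2 X3 X4 =>
  bil (h x) (curvature_op h x X1 X2 X3) X4.

Definition ricci h x : tensor2 := fun u v =>
  \tr (lin1_mx (fun w => curvature_op h x w u v)).

Definition scalar_curvature h x : R := gtrace (h x) (ricci h x).

Definition weyl h x : tensor4 := fun X1 X2 X3 X4 =>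
  curvature h x X1 X2 X3 X4
  - (n%:R - 2)^-1 * kn (bil (h x)) (ricci h x) X1 X2 X3 X4
  + scalar_curvature h x / ((n%:R - 2) * (n%:R - 1))
    * Gtensor (h x) X1 X2 X3 X4.

End LocalGeometry.

Section Smooth.
Context {R : realType} {n : nat} {W : normedModType R}.

Definition iter_partial (s : seq 'I_n) (f : 'rV[R]_n -> W) : 'rV[R]_n -> W :=
  foldr (fun i h x => 'D_('e_i) h x) f s.

Definition smooth_on (U : set 'rV[R]_n) (f : 'rV[R]_n -> W) : Prop :=
  forall (s : seq 'I_n) x, U x -> differentiable (iter_partial s f) x.

End Smooth.

Definition paracompact (T : topologicalType) : Prop :=
  forall F : set (set T), F `<=` open -> \bigcup_(U in F) U = setT ->
  exists G : set (set T),
    [/\ G `<=` open, \bigcup_(U in G) U = setT,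
        forall A, G A -> exists2 U, F U & A `<=` U
      & forall x : T, exists2 N, nbhs x N &
          finite_set [set A | G A /\ A `&` N !=set0]].

Record chart (R : realType) (n : nat) (T : topologicalType) := Chart {
  cdom : set T;
  cimg : set 'rV[R]_n;
  coord :> T -> 'rV[R]_n;
  cinv : 'rV[R]_n -> T;
  cdom_open : open cdom;
  cimg_open : open cimg;
  coord_img : forall p, cdom p -> cimg (coord p);
  cinv_dom : forall x, cimg x -> cdom (cinv x);
  coordK : forall p, cdom p -> cinv (coord p) = p;
  cinvK : forall x, cimg x -> coord (cinv x) = x;
  coord_continuous : {within cdom, continuous coord};
  cinv_continuous : {within cimg, continuous cinv} }.

Definition transition (R : realType) (n : nat) (T : topologicalType)
  (a b : chart R n T) : 'rV[R]_n -> 'rV[R]_n := fun x => b (cinv a x).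

Definition transition_dom (R : realType) (n : nat) (T : topologicalType)
  (a b : chart R n T) : set 'rV[R]_n :=
  [set x | cimg a x /\ cdom b (cinv a x)].

(* The C^oo structure is given by an atlas, not required to be maximal. *)
Record manifold (R : realType) (n : nat) := Manifold {
  space :> topologicalType;
  space_hausdorff : hausdorff_space space;
  space_connected : connected [set: space];
  space_paracompact : paracompact space;
  atlas : set (chart R n space);
  atlas_cover : forall p : space, exists2 a, atlas a & cdom a p;
  atlas_smooth : forall a b, atlas a -> atlas b ->
    smooth_on (transition_dom a b) (transition a b) }.

Definition chart_at (R : realType) (n : nat) (M : manifold R n) (p : M)
  (a : chart R n M) : Prop := atlas a /\ cdom a p.

(* [metric_mx a x] is the matrix (g_ij) at the point of coordinates x in the
   chart a. Its signature is locally constant, hence constant on M. *)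
Record metric (R : realType) (n : nat) (M : manifold R n) := Metric {
  metric_mx :> chart R n M -> 'rV[R]_n -> 'M[R]_n;
  metric_sym : forall a x, atlas a -> cimg a x ->
    (metric_mx a x)^T = metric_mx a x;
  metric_nondegenerate : forall a x, atlas a -> cimg a x ->
    metric_mx a x \in unitmx;
  metric_smooth : forall a, atlas a -> smooth_on (cimg a) (metric_mx a);
  metric_transform : forall a b x u v, atlas a -> atlas b ->
    transition_dom a b x ->
    bil (metric_mx a x) u v =
    bil (metric_mx b (transition a b x))
      ('D_u (transition a b) x) ('D_v (transition a b) x) }.

(* An equality of tensors at p means the equality of their components in every
   chart at p. *)
Definition U_S (R : realType) (n : nat) (M : manifold R n) (g : metric M)
  : set M := [set p | ~ forall a, chart_at p a -> forall X Y,
    ricci (g a) (a p) X Y =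
    scalar_curvature (g a) (a p) / n%:R * bil (g a (a p)) X Y].

Definition U_C (R : realType) (n : nat) (M : manifold R n) (g : metric M)
  : set M := [set p | ~ forall a, chart_at p a -> forall X1 X2 X3 X4,
    weyl (g a) (a p) X1 X2 X3 X4 = 0].

(* Main.v *)
From HB Require Import structures.
Require Import Defs.
From mathcomp Require Import all_boot all_order all_algebra.
From mathcomp Require Import all_classical all_reals all_analysis.
From mathcomp Require Import ring lra.

(* At a point, write s for the Ricci operator and q(X, Y) for the derivation
   (X wedge_g Y) applied to S, that is Q(g, S). Tracing the decomposition of R
   gives phi S(s ., .) = al S + be g with explicit al, be; since S is not
   proportional to g and C is not 0, this trace also forces phi <> 0. For each
   of the operators A = R(X, Y), C(X, Y), X wedge_g Y and X wedge_S Y one then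
   has A.g = a q and A.S = b q with scalars a, b, so that
     A.(x/2 S^S + y g^S + z G) = (x b + y a) S^q + (y b + z a) g^q.
   As R and C are both of this form, each identity reduces to the equality of
   its coefficients at S^q and g^q.
   The symmetry of S comes from the pair symmetry of R, which follows from the
   first Bianchi identity, because the assumed form of R makes it skew in its
   last two arguments. *)

Set Implicit Arguments.
Unset Strict Implicit.
Unset Printing Implicit Defensive.

Import Order.TTheory GRing.Theory Num.Theory.
Import numFieldNormedType.Exports.
Local Open Scope classical_set_scope.
Local Open Scope ring_scope.

(** * Derivations acting on tensors [x/2 S^S + y g^S + z G] *)

Section RoterTensors.
Context {R : realType} {n : nat}.
Local Notation V := 'rV[R]_n.
Implicit Types (g : 'M[R]_n) (E F S : @tensor2 R n) (T : @tensor4 R n) (A : V -> V).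

Lemma scalar_bil g (X : V) : scalar (bil g X).
Proof. by move=> k Y Z; rewrite bilDr bilZr. Qed.

Lemma gtraceZ g k E : gtrace g (fun X Y => k * E X Y) = k * gtrace g E.
Proof.
rewrite /gtrace mulr_sumr; apply: eq_bigr => i _.
by rewrite mulr_sumr; apply: eq_bigr => j _; rewrite mulrCA.
Qed.

Lemma gtraceD g E F :
  gtrace g (fun X Y => E X Y + F X Y) = gtrace g E + gtrace g F.
Proof.
rewrite /gtrace -big_split/=; apply: eq_bigr => i _.
by rewrite -big_split/=; apply: eq_bigr => j _; rewrite mulrDr.
Qed.

Lemma gtrace_bil g : g \in unitmx -> g^T = g -> gtrace g (bil g) = n%:R.
Proof.
move=> gU gT; rewrite -[RHS](mxtrace1 R n) -(mulVmx gU) /gtrace /mxtrace.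
apply: eq_bigr => i _; rewrite mxE; apply: eq_bigr => j _.
rewrite (bilC _ _ gT); congr (_ * _).
by rewrite /bil trmx_delta -colE -rowE !mxE.
Qed.

Lemma sharp0E g (alpha : V -> R) i :
  sharp g alpha 0 i = \sum_j invmx g j i * alpha 'e_j.
Proof. by rewrite /sharp mxE; apply: eq_bigr => j _; rewrite mxE mulrC. Qed.

Lemma scalar_sum_delta (alpha : V -> R) X :
  scalar alpha -> alpha X = \sum_i X 0 i * alpha 'e_i.
Proof.
move=> alin; pose L := GRing.isLinear.Build R V R *%R alpha alin.
pose beta : {linear V -> R | *%R} := HB.pack alpha L.
rewrite [in LHS](row_sum_delta X) -[alpha]/(beta : V -> R) linear_sum.
by apply: eq_bigr => i _; rewrite linearZ.
Qed.

Lemma invmx_sym g : g^T = g -> (invmx g)^T = invmx g.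
Proof. by move=> gT; rewrite trmx_inv gT. Qed.

Lemma gtrace_mul g (alpha beta : V -> R) :
  g^T = g -> scalar beta ->
  gtrace g (fun X Y => beta X * alpha Y) = beta (sharp g alpha).
Proof.
move=> gT blin; rewrite (scalar_sum_delta _ blin) /gtrace.
apply: eq_bigr => i _; rewrite sharp0E mulr_suml; apply: eq_bigr => j _.
by rewrite -[in LHS](invmx_sym gT) mxE; ring.
Qed.

Lemma bilZl g k (X Z : V) : bil g (k *: X) Z = k * bil g X Z.
Proof. by rewrite /bil -!scalemxAl mxE. Qed.

Lemma bilNl g (X Z : V) : bil g (- X) Z = - bil g X Z.
Proof. by rewrite -scaleN1r bilZl mulN1r. Qed.

Lemma bilNr g (X Z : V) : bil g Z (- X) = - bil g Z X.
Proof. by rewrite -scaleN1r bilZr mulN1r. Qed.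

(** The Roter form. With [E] the Ricci tensor, R and C both have it and differ only in [y] and [z],
    so one computation serves both. *)
Definition roter g E (x y z : R) : @tensor4 R n := fun X1 X2 X3 X4 =>
  x / 2 * kn E E X1 X2 X3 X4 + y * kn (bil g) E X1 X2 X3 X4
  + z * Gtensor g X1 X2 X3 X4.

Lemma roter_skew34 g E x y z X1 X2 X3 X4 :
  roter g E x y z X1 X2 X3 X4 = - roter g E x y z X1 X2 X4 X3.
Proof. by rewrite /roter /Gtensor /kn; field. Qed.

Definition derive2_by A E : @tensor2 R n := fun X1 X2 =>
  - (E (A X1) X2 + E X1 (A X2)).

Lemma derive_by_kn A E F X1 X2 X3 X4 :
  derive_by A (kn E F) X1 X2 X3 X4 =
  kn (derive2_by A E) F X1 X2 X3 X4 + kn E (derive2_by A F) X1 X2 X3 X4.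
Proof. by rewrite /derive_by /kn /derive2_by; ring. Qed.

(** By the Leibniz rule; the two equal terms from [E^E], and likewise from [g^g], cancel the halves
    in [roter]. *)
Lemma derive_by_roter g E F A a b x y z X1 X2 X3 X4 :
  (forall X Y, derive2_by A (bil g) X Y = a * F X Y) ->
  (forall X Y, derive2_by A E X Y = b * F X Y) ->
  derive_by A (roter g E x y z) X1 X2 X3 X4 =
  (x * b + y * a) * kn E F X1 X2 X3 X4
  + (y * b + z * a) * kn (bil g) F X1 X2 X3 X4.
Proof.
move=> Ag AE.
transitivity (x / 2 * derive_by A (kn E E) X1 X2 X3 X4
  + y * derive_by A (kn (bil g) E) X1 X2 X3 X4
  + z / 2 * derive_by A (kn (bil g) (bil g)) X1 X2 X3 X4).
  by rewrite /derive_by /roter /Gtensor; field.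
by rewrite !derive_by_kn /kn !Ag !AE; field.
Qed.

Section Point.
Variables g r : 'M[R]_n.
Hypotheses (gU : g \in unitmx) (gT : g^T = g) (rT : r^T = r).
Local Notation S := (bil r).
Local Notation s X := (sharp g (bil r X)).
Local Notation q X Y := (derive2_by (wedge_op (bil g) X Y) S).

Let bs X Y : bil g (s X) Y = S X Y.
Proof. by rewrite bil_sharp//; exact: scalar_bil. Qed.

Let bsr X Y : bil g Y (s X) = S X Y.
Proof. by rewrite bilC. Qed.

Let bilinE := (@bilDl R n, @bilDr R n, @bilZr R n, bilZl, bilNl, bilNr, bs, bsr).

Lemma opr_roter x y z X Y Z :
  opr g (roter g S x y z) X Y Z =
  x *: (S Y Z *: s X + (- S X Z) *: s Y)
  + y *: (S Y Z *: X + bil g Y Z *: s X + (- S X Z) *: Y + (- bil g X Z) *: s Y)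
  + z *: (bil g Y Z *: X + (- bil g X Z) *: Y).
Proof.
(* A vector is recovered from its pairings with g, so both sides are compared on a test vector
   [T]. *)
set W := RHS; rewrite /opr -[RHS](sharp_bil W gU); congr sharp.
apply/funext => T; rewrite /W !bilinE /roter /Gtensor /kn.
by field.
Qed.

(** The operator is g-skew because the tensor is skew in its last two arguments. The factor [0 * q]
    gives the shape that [derive_by_roter] expects. *)
Lemma derive2_roter_metric x y z X Y X1 X2 :
  derive2_by (opr g (roter g S x y z) X Y) (bil g) X1 X2 = 0 * q X Y X1 X2.
Proof.
rewrite /derive2_by !opr_roter !bilinE.
rewrite (bilC X1 X gT) (bilC X1 Y gT) (bilC X1 X rT) (bilC X1 Y rT).
by ring.
Qed.

(** After substituting for [S (s U) W], the S-S and g-g products are skew in [X1], [X2] and cancel;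
    the mixed products make up [q]. *)
Lemma derive2_roter_ricci al be x y z X Y X1 X2 :
  (forall U W, S (s U) W = al * S U W + be * bil g U W) ->
  derive2_by (opr g (roter g S x y z) X Y) S X1 X2 =
  (- x * be + y * al + z) * q X Y X1 X2.
Proof.
move=> S2; rewrite /derive2_by !opr_roter /wedge_op !bilinE.
rewrite !(bilC X1 (s _) rT) !S2.
rewrite (bilC X1 X rT) (bilC X1 Y rT).
by ring.
Qed.

Lemma derive2_wedge_metric_metric X Y X1 X2 :
  derive2_by (wedge_op (bil g) X Y) (bil g) X1 X2 = 0 * q X Y X1 X2.
Proof.
rewrite /derive2_by /wedge_op !bilinE (bilC X1 X gT) (bilC X1 Y gT).
by ring.
Qed.

Lemma derive2_wedge_ricci_metric X Y X1 X2 :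
  derive2_by (wedge_op S X Y) (bil g) X1 X2 = - 1 * q X Y X1 X2.
Proof.
rewrite /derive2_by /wedge_op !bilinE.
rewrite (bilC X1 X gT) (bilC X1 Y gT) (bilC X1 X rT) (bilC X1 Y rT).
by ring.
Qed.

Lemma derive2_wedge_ricci_ricci X Y X1 X2 :
  derive2_by (wedge_op S X Y) S X1 X2 = 0 * q X Y X1 X2.
Proof.
rewrite /derive2_by /wedge_op !bilinE (bilC X1 X rT) (bilC X1 Y rT).
by ring.
Qed.

(** Both identities as pure algebra at a point: [kappa] is any scalar for which the traced
    decomposition holds. *)
Lemma roter_identities phi mu eta kappa (N := n%:R : R) :
  phi != 0 -> N - 2 != 0 -> N - 1 != 0 ->
  (forall U W, S U W = phi * (kappa * S U W - S (s U) W)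
    + mu * (N * S U W + kappa * bil g U W - 2 * S U W)
    + eta * (N - 1) * bil g U W) ->
  let Rm := roter g S phi mu eta in
  let C := roter g S phi (mu - (N - 2)^-1)
             (eta + kappa / ((N - 2) * (N - 1))) in
  let L_R := phi^-1 * ((N - 2) * (mu ^+ 2 - phi * eta) - mu) in
  let L := L_R + mu / phi in
  let L_C := L_R - kappa / (N - 1) + ((N - 2) * phi)^-1 - mu / phi in
  forall X1 X2 X3 X4 X Y,
  dot g C Rm X1 X2 X3 X4 X Y + dot g Rm C X1 X2 X3 X4 X Y =
    Qtensor S C X1 X2 X3 X4 X Y
    + (L + L_C - ((N - 2) * phi)^-1) * Qtensor (bil g) C X1 X2 X3 X4 X Y
  /\
  dot g C Rm X1 X2 X3 X4 X Y - dot g Rm C X1 X2 X3 X4 X Y =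
    Qtensor S C X1 X2 X3 X4 X Y
    - kappa / (N - 1) * Qtensor (bil g) C X1 X2 X3 X4 X Y.
Proof.
move=> phi0 N2 N1 tr Rm C L_R L L_C X1 X2 X3 X4 X Y.
(* The trace equation solved for [S (s U) W], dividing by [phi]. *)
pose al := kappa + (mu * (N - 2) - 1) / phi.
pose be := (mu * kappa + eta * (N - 1)) / phi.
have S2 U W : S (s U) W = al * S U W + be * bil g U W.
  have e : phi * S (s U) W = phi * (kappa * S U W)
      + mu * (N * S U W + kappa * bil g U W - 2 * S U W)
      + eta * (N - 1) * bil g U W - S U W.
    by rewrite [X in _ - X]tr; ring.
  by apply: (mulfI phi0); rewrite e /al /be; field.
rewrite /dot /Qtensor /Rm /C.
(* The pairs (a, b) are (0, - phi be + y al + z) for R and C, each with its own y and z, then (-1,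
   0) for the S-wedge and (0, 1) for the g-wedge. *)
rewrite !(derive_by_roter _ _ _ _ _ _ _ (derive2_roter_metric _ _ _ X Y)
  (fun U W => derive2_roter_ricci _ _ _ X Y U W S2)).
rewrite (derive_by_roter _ _ _ _ _ _ _
  (derive2_wedge_ricci_metric X Y) (derive2_wedge_ricci_ricci X Y)).
rewrite (derive_by_roter _ _ _ _ _ _ _
  (derive2_wedge_metric_metric X Y) (fun U W => esym (mul1r (q X Y U W)))).
rewrite /L /L_C /L_R /al /be.
(* Only coefficients remain to be compared, so [S^q] and [g^q] become free scalars. *)
move: (kn _ _ _ _ _ _) (kn _ _ _ _ _ _) => k1 k2.
split; field; by rewrite ?phi0 ?N1 ?N2.
Qed.
End Point.
End RoterTensors.

(** * Derivability of determinants and inverse matrices *)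

Section Derivability.
Context {R : realType} {V : normedModType R}.
Implicit Types x v : V.

Lemma derivable_sumf {I : Type} (r : seq I) (P : pred I) (f : I -> V -> R) x v :
  (forall i, derivable (f i) x v) ->
  derivable (fun y => \sum_(i <- r | P i) f i y) x v.
Proof.
move=> df; elim: r => [|i r IH].
  by under eq_fun do rewrite big_nil; exact: derivable_cst.
under eq_fun do rewrite big_cons.
by case: (P i); [exact: derivableD|].
Qed.

Lemma derivable_prodf {I : Type} (r : seq I) (P : pred I) (f : I -> V -> R) x v :
  (forall i, derivable (f i) x v) ->
  derivable (fun y => \prod_(i <- r | P i) f i y) x v.
Proof.
move=> df; elim: r => [|i r IH].
  by under eq_fun do rewrite big_nil; exact: derivable_cst.
under eq_fun do rewrite big_cons.
by case: (P i); [exact: derivableM|].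
Qed.

Lemma derivable_det m (A : V -> 'M[R]_m) x v :
  derivable A x v -> derivable (fun y => \det (A y)) x v.
Proof.
move=> /derivable_mxP dA; apply: derivable_sumf => s.
apply: derivableM; first exact: derivable_cst.
by apply: derivable_prodf => i; exact: dA.
Qed.

(** Cramer's formula: adjugate over determinant. Invertibility near [x] keeps [invmx] off its
    default branch. *)
Lemma derivable_invmx m (A : V -> 'M[R]_m) x v :
  (\forall y \near x, A y \in unitmx) -> derivable A x v ->
  derivable (fun y => invmx (A y)) x v.
Proof.
move=> AU dA; apply/derivable_mxP => i j.
apply: (@near_eq_derivable _ _ _
  (fun y => (\det (A y))^-1 * (\adj (A y) i j))).
  near=> y; rewrite /= /invmx (_ : A y \in unitmx); last by near: y.
  by rewrite [RHS]mxE.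
apply: derivableM.
  apply: derivableV; last exact: derivable_det.
  by move/nbhs_singleton: AU; rewrite unitmxE unitfE.
under eq_fun do rewrite mxE /cofactor.
apply: derivableM; first exact: derivable_cst.
apply: derivable_det; apply/derivable_mxP => k l.
under eq_fun do rewrite !mxE.
by move/derivable_mxP: dA; apply.
Unshelve. all: by end_near. Qed.

End Derivability.

(** * Symmetries and linearity of the curvature in coordinates *)

Section LeviCivita.
Context {R : realType} {n : nat}.
Local Notation V := 'rV[R]_n.
Implicit Types (h : V -> 'M[R]_n) (x u v w : V).

Lemma sharpP (g : 'M[R]_n) k (al be : V -> R) :
  sharp g (fun w => k * al w + be w) = k *: sharp g al + sharp g be.
Proof.
rewrite /sharp scalemxAl -mulmxDl; congr (_ *m _).
by apply/rowP => i; rewrite !mxE.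
Qed.

Lemma derive_bil_cst h x u v w : differentiable h x ->
  'D_u (fun y => bil (h y) v w) x = bil ('D_u h x) v w.
Proof.
move=> dh; rewrite (@derive_bil _ _ h (cst v) (cst w))// !derive_cst.
by rewrite bil0l bil0r !addr0.
Qed.

Lemma christoffelPr h x u k v w : differentiable h x ->
  christoffel h x u (k *: v + w) =
  k *: christoffel h x u v + christoffel h x u w.
Proof.
move=> dh; rewrite /christoffel -sharpP; congr sharp; apply/funext => e.
(* Differentiability of [h] makes the derivative linear in its direction. *)
rewrite !derive_bil_cst// (_ : 'D_(k *: v + w) h x =
    k *: 'D_v h x + 'D_w h x); last by rewrite !(deriveE _ dh) linearP.
move: ('D_u h x) ('D_v h x) ('D_w h x) ('D_e h x) => A B C D.
by rewrite bilDg bilZg !bilDl !bilDr !bilZl !bilZr; ring.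
Qed.

Lemma christoffel0r h x u : differentiable h x -> christoffel h x u 0 = 0.
Proof.
move=> dh; have := christoffelPr u (-1) 0 0 dh.
by rewrite scaler0 addr0 scaleN1r addNr.
Qed.

Lemma derivable_bil (D : V -> 'M[R]_n) x u v w :
  derivable D x w -> derivable (fun y => bil (D y) u v) x w.
Proof.
move=> /derivable_mxP dD; under eq_fun do rewrite bilE.
apply: derivable_sumf => j; apply: derivable_sumf => i.
apply: derivableM; last exact: derivable_cst.
by apply: derivableM; [exact: derivable_cst|exact: dD].
Qed.

Section Regular.
Variables (h : V -> 'M[R]_n) (x : V).
Hypotheses (hU : \forall y \near x, h y \in unitmx).
Hypotheses (hT : \forall y \near x, (h y)^T = h y).
Hypotheses (dh : \forall y \near x, differentiable h y).
Hypotheses (ddh : forall i, differentiable (fun y => 'D_('e_i) h y) x).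

Let dhx : differentiable h x. Proof. exact: nbhs_singleton dh. Qed.

(** Near [x] the derivative along [u] is a fixed combination of the partials covered by [ddh]. *)
Lemma derivable_derive u w : derivable (fun y => 'D_u h y) x w.
Proof.
apply: (@near_eq_derivable _ _ _ (fun y => \sum_i u 0 i *: 'D_('e_i) h y)).
  near=> y; have dy : differentiable h y by near: y.
  rewrite [in RHS](row_sum_delta u) deriveE// linear_sum.
  by apply: eq_bigr => i _; rewrite linearZ deriveE.
apply/derivable_mxP => k l.
under eq_fun do rewrite summxE.
apply: derivable_sumf => i; under eq_fun do rewrite mxE.
apply: derivableM; first exact: derivable_cst.
by have /derivable_mxP := @diff_derivable _ _ _ _ _ w (ddh i); exact.
Unshelve. all: by end_near. Qed.

(** Needed to differentiate linear combinations of Christoffel terms in [curvature_opP]. *)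
Lemma derivable_christoffel u v w : derivable (fun y => christoffel h y u v) x w.
Proof.
apply: (@near_eq_derivable _ _ _ (fun y =>
  (\row_l (2^-1 * (bil ('D_u h y) v 'e_l + bil ('D_v h y) u 'e_l
     - bil ('D_('e_l) h y) u v))) *m invmx (h y))).
  near=> y; have dy : differentiable h y by near: y.
  congr (_ *m _); apply/rowP => l.
  by rewrite !mxE !derive_bil_cst.
apply/derivable_mxP => i j; under eq_fun do rewrite mxE.
apply: derivable_sumf => l; under eq_fun do rewrite mxE.
apply: derivableM; last first.
  have /derivable_mxP := derivable_invmx hU (@diff_derivable _ _ _ _ _ w dhx).
  exact.
apply: derivableM; first exact: derivable_cst.
apply: derivableB; last exact/derivable_bil/derivable_derive.
by apply: derivableD; exact/derivable_bil/derivable_derive.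
Unshelve. all: by end_near. Qed.

(** Constant fields have zero bracket, and their covariant derivatives are Christoffel terms. *)
Lemma curvature_opE u v w : curvature_op h x u v w =
  'D_u (fun y => christoffel h y v w) x + christoffel h x u (christoffel h x v w)
  - ('D_v (fun y => christoffel h y u w) x
     + christoffel h x v (christoffel h x u w)).
Proof.
have ncst a b : nabla h (fun=> a) (fun=> b) = fun y => christoffel h y a b.
  by apply/funext => y; rewrite /nabla derive_cst add0r.
have lie0 : lie_bracket (fun=> u) (fun=> v) = fun=> 0 :> V.
  by apply/funext => y; rewrite /lie_bracket !derive_cst subr0.
have n0 : nabla h (fun=> 0) (fun=> w) x = 0.
  by rewrite ncst (christoffelC 0 w hT) (christoffel0r w dhx).
by rewrite /curvature_op /curvature_field lie0 n0 subr0 !ncst.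
Qed.

Lemma curvature_opC u v w : curvature_op h x u v w = - curvature_op h x v u w.
Proof. by rewrite !curvature_opE opprB. Qed.

(** Christoffel terms, and hence their derivatives, are symmetric in the two lower arguments, so the
    cyclic sum cancels in pairs. *)
Lemma curvature_op_bianchi u v w :
  curvature_op h x u v w + curvature_op h x v w u + curvature_op h x w u v = 0.
Proof.
(* Abstracting the two terms keeps unification from unfolding derivatives. *)
have [D [G [DC GC opE]]] : exists (D : V -> V -> V -> V) (G : V -> V -> V),
    [/\ forall a b c, D a b c = D a c b, forall a b, G a b = G b a
    & forall a b c, curvature_op h x a b c =
        D a b c + G a (G b c) - (D b a c + G b (G a c))].
  exists (fun a b c => 'D_a (fun y => christoffel h y b c) x), (christoffel h x).
  split=> [a b c|a b|]; last exact: curvature_opE.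
    apply: near_eq_derive; have := near_join hT.
    by apply: filterS => y hy; exact: christoffelC.
  exact: christoffelC.
rewrite !opE (DC u w v) (DC v u w) (DC w v u) (GC w v) (GC u w) (GC v u).
by apply/rowP => i; rewrite !mxE; ring.
Qed.

Lemma curvature_opP u v k w z : curvature_op h x u v (k *: w + z) =
  k *: curvature_op h x u v w + curvature_op h x u v z.
Proof.
have [D [G [DP GP opE]]] : exists (D : V -> V -> V -> V) (G : V -> V -> V),
    [/\ forall a b k w z, D a b (k *: w + z) = k *: D a b w + D a b z,
    forall a k w z, G a (k *: w + z) = k *: G a w + G a z
    & forall a b c, curvature_op h x a b c =
        D a b c + G a (G b c) - (D b a c + G b (G a c))].
  exists (fun a b c => 'D_a (fun y => christoffel h y b c) x), (christoffel h x).
  split; [|by move=> *; exact: christoffelPr|exact: curvature_opE].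
  move=> a b l w1 w2.
  have dc c := @derivable_christoffel b c a.
  rewrite -deriveZ// -deriveD//; last exact: derivableZ.
  apply: near_eq_derive; near=> y; apply: christoffelPr; near: y.
  exact: dh.
rewrite !opE !DP !GP.
by apply/rowP => i; rewrite !mxE; ring.
Unshelve. all: by end_near. Qed.

Let gU : h x \in unitmx. Proof. exact: nbhs_singleton hU. Qed.
Let gT : (h x)^T = h x. Proof. exact: nbhs_singleton hT. Qed.

(** The i-th diagonal entry is the i-th coordinate of [curvature_op] at ['e_i], which [sharp_bil]
    recovers from its pairings with the metric. *)
Lemma ricci_gtrace u v :
  ricci h x u v = gtrace (h x) (fun X Y => curvature h x X u v Y).
Proof.
rewrite /ricci /mxtrace /gtrace; apply: eq_bigr => i _.
rewrite /lin1_mx mxE -[curvature_op _ _ _ _ _ in LHS](sharp_bil _ gU) sharp0E.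
by apply: eq_bigr => j _; rewrite -[in RHS](invmx_sym gT) mxE.
Qed.

Lemma scalar_ricci u : scalar (ricci h x u).
Proof.
move=> k v w; rewrite !ricci_gtrace -gtraceZ -gtraceD; congr gtrace.
apply/funext => X; apply/funext => Y.
by rewrite /curvature curvature_opP bilDl bilZl.
Qed.

End Regular.
End LeviCivita.

(** * Metric traces: symmetry of S, the traced decomposition, and the case phi = 0 *)

Section RoterTraces.
Context {R : realType} {n : nat}.
Local Notation V := 'rV[R]_n.
Implicit Types (g : 'M[R]_n).

Lemma pair_symmetry (T : @tensor4 R n) :
  (forall X1 X2 X3 X4, T X1 X2 X3 X4 = - T X2 X1 X3 X4) ->
  (forall X1 X2 X3 X4, T X1 X2 X3 X4 = - T X1 X2 X4 X3) ->
  (forall X1 X2 X3 X4, T X1 X2 X3 X4 + T X2 X3 X1 X4 + T X3 X1 X2 X4 = 0) ->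
  forall X1 X2 X3 X4, T X1 X2 X3 X4 = T X3 X4 X1 X2.
Proof.
move=> skew12 skew34 bianchi a b c d.
(* Bianchi at the four cyclic shifts of a, b, c, d; with the sign changes below, the claim is a
   linear consequence. *)
move: (bianchi a b c d) (bianchi b c d a) (bianchi c d a b) (bianchi d a b c).
move: (skew34 b c d a) (skew34 c d b a) (skew12 d b c a) (skew34 b d c a).
move: (skew34 d a c b) (skew12 a c d b) (skew34 c a d b) (skew34 a b d c).
lra.
Qed.

(** [T X u v Y = T v Y X u = T Y v u X], and the trace is symmetric in the slots X, Y. *)
Lemma gtrace_pair_symmetric g (T : @tensor4 R n) u v : g^T = g ->
  (forall X1 X2 X3 X4, T X1 X2 X3 X4 = - T X2 X1 X3 X4) ->
  (forall X1 X2 X3 X4, T X1 X2 X3 X4 = - T X1 X2 X4 X3) ->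
  (forall X1 X2 X3 X4, T X1 X2 X3 X4 + T X2 X3 X1 X4 + T X3 X1 X2 X4 = 0) ->
  gtrace g (fun X Y => T X u v Y) = gtrace g (fun X Y => T X v u Y).
Proof.
move=> gT skew12 skew34 bianchi.
rewrite /gtrace exchange_big; apply: eq_bigr => i _; apply: eq_bigr => j _.
rewrite -[in LHS](invmx_sym gT) mxE; congr (_ * _).
by rewrite (pair_symmetry skew12 skew34 bianchi) skew12 skew34 opprK.
Qed.

(** Turns the Ricci tensor into a symmetric matrix, as the pointwise algebra requires; symmetry
    supplies linearity in the first slot. *)
Lemma bil_of_scalar (E : @tensor2 R n) :
  (forall X, scalar (E X)) -> (forall X Y, E X Y = E Y X) ->
  let r := \matrix_(i, j) E 'e_i 'e_j in r^T = r /\ E = bil r.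
Proof.
move=> Elin EC r; split; first by apply/matrixP => i j; rewrite !mxE EC.
apply/funext => X; apply/funext => Y; rewrite bilE.
rewrite (scalar_sum_delta Y (Elin X)); apply: eq_bigr => j _.
rewrite EC (scalar_sum_delta X (Elin _)) mulr_sumr; apply: eq_bigr => i _.
by rewrite mxE EC; ring.
Qed.

Lemma gtrace_roter g r x y z u v (kappa := gtrace g (bil r)) :
  g \in unitmx -> g^T = g -> r^T = r ->
  gtrace g (fun X Y => roter g (bil r) x y z X u v Y) =
  x * (kappa * bil r u v - bil r (sharp g (bil r u)) v)
  + y * (n%:R * bil r u v + kappa * bil g u v - 2 * bil r u v)
  + z * (n%:R - 1) * bil g u v.
Proof.
move=> gU gT rT.
(* Sorted by the traced slots: [bil r X Y] and [bil g X Y] trace to [kappa] and n, the four products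
   of covectors by [gtrace_mul]. *)
transitivity (gtrace g (fun X Y =>
  (x * bil r u v + y * bil g u v) * bil r X Y
  + ((y * bil r u v + z * bil g u v) * bil g X Y
  + ((- x) * (bil r v X * bil r u Y)
  + ((- y) * (bil g v X * bil r u Y)
  + ((- y) * (bil r v X * bil g u Y)
  + (- z) * (bil g v X * bil g u Y))))))).
  congr gtrace; apply/funext => X; apply/funext => Y.
  rewrite /roter /Gtensor /kn (bilC v X gT) (bilC v X rT).
  by field.
rewrite !gtraceD !gtraceZ gtrace_bil// !gtrace_mul//; try exact: scalar_bil.
rewrite !sharp_bil// -/kappa (bilC v _ rT) (bilC v (sharp _ _) gT).
rewrite bil_sharp//; last exact: scalar_bil.
rewrite (bilC v u rT) (bilC v u gT).
by ring.
Qed.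

(* With [phi = 0] the trace gives [(1 - (n-2) mu) S = c g], so that either S is
   proportional to g or [mu = 1/(n-2)] and the Weyl tensor vanishes. *)
Lemma roter_degenerate g r mu eta (N := n%:R : R) (kappa := gtrace g (bil r)) :
  g \in unitmx -> g^T = g -> r^T = r -> N != 0 -> N - 2 != 0 -> N - 1 != 0 ->
  (forall u v, bil r u v =
    gtrace g (fun X Y => roter g (bil r) 0 mu eta X u v Y)) ->
  if mu == (N - 2)^-1 then eta + kappa / ((N - 2) * (N - 1)) = 0
  else forall u v, bil r u v = kappa / N * bil g u v.
Proof.
move=> gU gT rT N0 N2 N1 tr.
pose c := mu * kappa + eta * (N - 1).
have e u v : (1 - mu * (N - 2)) * bil r u v = c * bil g u v.
  apply/eqP; rewrite -subr_eq0 mulrBl mul1r [X in X - _ - _]tr gtrace_roter//.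
  by apply/eqP; rewrite -/kappa -/N /c; ring.
(* The trace of [e], which determines [c]. *)
have ek : (1 - mu * (N - 2)) * kappa = c * N.
  have -> : c * N = gtrace g (fun X Y => c * bil g X Y).
    by rewrite gtraceZ gtrace_bil.
  rewrite -gtraceZ; congr gtrace.
  by apply/funext => u; apply/funext => v; exact: e.
(* If the left factor of [ek] vanishes then [c = 0], and dividing by [N - 1] gives the claim;
   otherwise that factor is cancelled from [e]. *)
case: eqVneq => [muE|mu_neq].
  move: ek; rewrite muE mulVf// subrr mul0r => /esym/eqP.
  rewrite mulf_eq0 (negPf N0) orbF /c muE => /eqP ce.
  apply: (mulIf N1); rewrite mul0r -[RHS]ce.
  by field; rewrite N1 N2.
move=> u v; have d0 : 1 - mu * (N - 2) != 0.
  apply: contra_neq mu_neq => /eqP; rewrite subr_eq0 => /eqP d1.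
  by apply: (mulIf N2); rewrite -d1 mulVf.
apply: (mulfI d0); rewrite e.
have -> : c = (1 - mu * (N - 2)) * kappa / N by rewrite ek mulfK.
by ring.
Qed.

End RoterTraces.

(** * From a chart to matrices at a point *)

Section RoterChart.
Context {R : realType} {n : nat} {M : manifold R n}.
Variables (g : metric M) (p : M) (a : chart R n M).
Hypothesis pa : chart_at p a.
Local Notation h := (g a).
Local Notation x := (a p).

Let aA : atlas a. Proof. by case: pa. Qed.

Let near_cimg : \forall y \near x, cimg a y.
Proof.
apply: open_nbhs_nbhs; split; first exact: cimg_open.
by apply: coord_img; case: pa.
Qed.

Let hU : \forall y \near x, h y \in unitmx.
Proof. by near=> y; apply: (metric_nondegenerate g aA); near: y.
Unshelve. all: by end_near. Qed.

Let hT : \forall y \near x, (h y)^T = h y.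
Proof. by near=> y; apply: (Defs.metric_sym g aA); near: y.
Unshelve. all: by end_near. Qed.

Let dh : \forall y \near x, differentiable h y.
Proof. by near=> y; apply: (metric_smooth g aA [::]); near: y.
Unshelve. all: by end_near. Qed.

Let ddh i : differentiable (fun y => 'D_('e_i) h y) x.
Proof.
exact: (metric_smooth g aA [:: i] (nbhs_singleton near_cimg)).
Qed.

(** Bridge from geometry to the pointwise algebra. The last clause traces the assumed form of R,
    whose trace is S itself. *)
Lemma roter_ricci x1 y1 z1 :
  curvature h x = roter (h x) (ricci h x) x1 y1 z1 ->
  exists r : 'M[R]_n, [/\ h x \in unitmx, (h x)^T = h x, r^T = r,
    ricci h x = bil r & forall u v, bil r u v =
    gtrace (h x) (fun X Y => roter (h x) (bil r) x1 y1 z1 X u v Y)].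
Proof.
move=> RE; set S := ricci h x.
have gU := nbhs_singleton hU; have gT := nbhs_singleton hT.
have skew12 X1 X2 X3 X4 : curvature h x X1 X2 X3 X4 = - curvature h x X2 X1 X3 X4.
  by rewrite /curvature (curvature_opC hT dh) bilNl.
have skew34 X1 X2 X3 X4 : curvature h x X1 X2 X3 X4 = - curvature h x X1 X2 X4 X3.
  by rewrite RE; exact: roter_skew34.
have bianchi X1 X2 X3 X4 : curvature h x X1 X2 X3 X4 + curvature h x X2 X3 X1 X4
    + curvature h x X3 X1 X2 X4 = 0.
  by rewrite /curvature -!bilDl (curvature_op_bianchi hT dh) bil0l.
have SC u v : S u v = S v u.
  rewrite /S (ricci_gtrace hU hT u v) (ricci_gtrace hU hT v u).
  exact: gtrace_pair_symmetric.
have [rT SE] := bil_of_scalar (scalar_ricci hU hT dh ddh) SC.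
exists (\matrix_(i, j) S 'e_i 'e_j); split=> // u v.
by rewrite -SE /S (ricci_gtrace hU hT) RE.
Qed.

End RoterChart.

Lemma natr_sub_neq0 (R : realType) (n k : nat) :
  (4 <= n)%N -> (k < 4)%N -> n%:R - k%:R != 0 :> R.
Proof.
move=> n4 k4; rewrite subr_eq0 eqr_nat gtn_eqF//.
exact: leq_trans k4 n4.
Qed.

(** * Nonvanishing of phi where S is not proportional to g and C is not 0 *)

Section PhiNonzero.
Context {R : realType} {n : nat} {M : manifold R n}.
Variable g : metric M.
Hypothesis n_ge4 : (4 <= n)%N.
Local Notation N := (n%:R : R).

Let N2 : N - 2 != 0. Proof. exact: (@natr_sub_neq0 R n 2 n_ge4). Qed.
Let N1 : N - 1 != 0. Proof. exact: (@natr_sub_neq0 R n 1 n_ge4). Qed.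
Let N0 : N != 0. Proof. by have := @natr_sub_neq0 R n 0 n_ge4 isT; rewrite subr0. Qed.

Lemma weyl_roter (h : 'rV[R]_n -> 'M[R]_n) x x1 y1 z1 :
  curvature h x = roter (h x) (ricci h x) x1 y1 z1 ->
  weyl h x = roter (h x) (ricci h x) x1 (y1 - (N - 2)^-1)
    (z1 + scalar_curvature h x / ((N - 2) * (N - 1))).
Proof.
move=> RE; apply/funext => X1; apply/funext => X2; apply/funext => X3.
apply/funext => X4; rewrite /weyl RE /roter.
move: (ricci h x) (scalar_curvature h x) => E k.
by field; rewrite N1 N2.
Qed.

Lemma roter_phi_neq0 (p : M) x1 y1 z1 :
  (U_S g `&` U_C g) p ->
  (forall a, chart_at p a ->
    curvature (g a) (a p) = roter (g a (a p)) (ricci (g a) (a p)) x1 y1 z1) ->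
  x1 != 0.
Proof.
move=> [US UC] RE; apply/negP => /eqP x10; subst x1.
(* The split is on a scalar independent of the chart, so each branch refutes [U_C] or [U_S] in all
   charts at once. *)
case: (eqVneq y1 (N - 2)^-1) => y1E; [apply: UC|apply: US] => a pa.
- move=> X1 X2 X3 X4; have [r [gU gT rT SE tr]] := roter_ricci pa (RE a pa).
  have := roter_degenerate gU gT rT N0 N2 N1 tr.
  rewrite y1E eqxx => z0.
  rewrite (weyl_roter (RE a pa)) y1E subrr /scalar_curvature SE z0.
  by rewrite /roter !mul0r !addr0.
- move=> X Y; have [r [gU gT rT SE tr]] := roter_ricci pa (RE a pa).
  have := roter_degenerate gU gT rT N0 N2 N1 tr.
  by rewrite (negPf y1E) /scalar_curvature SE; apply.
Qed.
End PhiNonzero.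

Unset Implicit Arguments.

Theorem proposition3p3 (R : realType) (n : nat) (M : manifold R n)
    (g : metric M) (phi mu eta : M -> R) :
  (4 <= n)%N ->
  (forall p : M, (U_S g `&` U_C g) p ->
   forall a : chart R n M, chart_at p a ->
   forall X1 X2 X3 X4 : 'rV[R]_n,
     let gp := g a (a p) in
     let S := ricci (g a) (a p) in
     curvature (g a) (a p) X1 X2 X3 X4 =
       phi p / 2 * kn S S X1 X2 X3 X4
       + mu p * kn (bil gp) S X1 X2 X3 X4
       + eta p * Gtensor gp X1 X2 X3 X4) ->
  forall p : M, (U_S g `&` U_C g) p ->
  forall a : chart R n M, chart_at p a ->
  forall X1 X2 X3 X4 X Y : 'rV[R]_n,
    let gp := g a (a p) in
    let Rm := curvature (g a) (a p) in
    let S := ricci (g a) (a p) in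
    let kappa := scalar_curvature (g a) (a p) in
    let C := weyl (g a) (a p) in
    let L_R := (phi p)^-1
      * ((n%:R - 2) * (mu p ^+ 2 - phi p * eta p) - mu p) in
    let L := L_R + mu p / phi p in
    let L_C := L_R - kappa / (n%:R - 1) + ((n%:R - 2) * phi p)^-1
      - mu p / phi p in
    dot gp C Rm X1 X2 X3 X4 X Y + dot gp Rm C X1 X2 X3 X4 X Y =
      Qtensor S C X1 X2 X3 X4 X Y
      + (L + L_C - ((n%:R - 2) * phi p)^-1)
        * Qtensor (bil gp) C X1 X2 X3 X4 X Y
    /\
    dot gp C Rm X1 X2 X3 X4 X Y - dot gp Rm C X1 X2 X3 X4 X Y =
      Qtensor S C X1 X2 X3 X4 X Y
      - kappa / (n%:R - 1) * Qtensor (bil gp) C X1 X2 X3 X4 X Y.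
Proof.
move=> n_ge4 hyp p Up a pa X1 X2 X3 X4 X Y gp Rm S kappa C L_R L L_C.
(* Stated for all charts at [p], since [U_S] and [U_C] quantify over all of them. *)
have RE b : chart_at p b -> curvature (g b) (b p) =
    roter (g b (b p)) (ricci (g b) (b p)) (phi p) (mu p) (eta p).
  move=> pb; apply/funext => Y1; apply/funext => Y2; apply/funext => Y3.
  by apply/funext => Y4; exact: hyp.
have phi0 := roter_phi_neq0 n_ge4 Up RE.
have [r [gU gT rT SE tr]] := roter_ricci pa (RE a pa).
have N1 := @natr_sub_neq0 R n 1 n_ge4 isT.
have N2 := @natr_sub_neq0 R n 2 n_ge4 isT.
(* The trace equation with [kappa] explicit, as [roter_identities] takes it. *)
have tr' u v := etrans (tr u v) (gtrace_roter (phi p) (mu p) (eta p) u v gU gT rT).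
have := roter_identities gU gT rT phi0 N2 N1 tr' X1 X2 X3 X4 X Y.
by rewrite /L /L_C /L_R /C /Rm /kappa (weyl_roter n_ge4 (RE a pa)) (RE a pa)
  /S /scalar_curvature SE.
Qed.
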